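(* Let $X$ be a nonempty compact Hausdorff space and let $E$ be a commutative Banach algebra with unit. Then $C(X,E)$ is a Ditkin algebra if and only if $E$ is a Ditkin algebra.
   Context: Banach algebras are over $\mathbb{C}$. $C(X,E)$ is the algebra of all continuous maps $X\to E$ with pointwise operations and the norm $\|f\|_X=\sup_{x\in X}\|f(x)\|$; it is a commutative Banach algebra with unit. Let $A$ be a commutative Banach algebra with unit (not assumed semisimple). $M(A)$ is the set of nonzero multiplicative linear functionals $A\to\mathbb{C}$ with the relative weak-star topology from $A^*$, and $\hat a(\phi)=\phi(a)$ for $a\in A$, $\phi\in M(A)$. The support $\mathrm{supp}(a)$ of $a\in A$ is the closure in $M(A)$ of $\{\phi\in M(A):\hat a(\phi)\neq 0\}$. For $\phi\in M(A)$ put $I_\phi=\{a\in A:\hat a(\phi)=0\}$ and $J_\phi=\{a\in A:\phi\notin \mathrm{supp}(a)\}$. $A$ satisfies Ditkin's condition at $\phi$ if $a$ belongs to the norm closure of $aJ_\phi=\{ab:b\in J_\phi\}$ for all $a\in I_\phi$. $A$ is a Ditkin algebra if it satisfies Ditkin's condition at every $\phi\in M(A)$. *)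

(* Defs.v *)
From HB Require Import structures.
From mathcomp Require Import all_boot all_order all_algebra.
From mathcomp Require Import all_classical all_reals all_analysis.
From mathcomp.real_closed Require Import complex.

Set Implicit Arguments.
Unset Strict Implicit.
Unset Printing Implicit Defensive.

Import Order.TTheory GRing.Theory Num.Theory.
Import numFieldNormedType.Exports.

Local Open Scope classical_set_scope.
Local Open Scope ring_scope.
Local Open Scope complex_scope.

Reserved Notation "a ** b" (at level 40, left associativity).

(* The product is an operation of its own, not that of a [GRing] ring: Hierarchy
   Builder admits no join of [GRing.PzSemiRing] and [Num.SemiNormedZmodule] other
   than [Num.NumDomain]. Neither |1| = 1 nor 1 != 0 is required. *)
HB.mixin Record CompleteNormedModule_isComBanachAlgebra (K : numFieldType) A
    & CompleteNormedModule K A := {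
  bone : A ;
  bmul : A -> A -> A ;
  bmulA : associative bmul ;
  bmulC : commutative bmul ;
  bmul1r : left_id bone bmul ;
  bmulDl : left_distributive bmul +%R ;
  bscalerAl : forall (k : K) (a b : A), k *: bmul a b = bmul (k *: a) b ;
  bnormM_le : forall a b : A, `|bmul a b| <= `|a| * `|b|
}.

#[short(type="comBanachAlgType")]
HB.structure Definition ComBanachAlgebra (K : numFieldType) :=
  {A of CompleteNormedModule K A & CompleteNormedModule_isComBanachAlgebra K A}.

Notation "a ** b" := (bmul a b) : ring_scope.

Section ditkin.
Context {R : realType} (A : comBanachAlgType R[i]).

(* Continuity is not required: it is automatic for multiplicative functionals
   on a Banach algebra. *)
Definition is_character (phi : A -> R[i]) : Prop :=
  [/\ scalar phi,
      (forall a b, phi (a ** b) = phi a * phi b)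
    & exists a, phi a <> 0].

(* The weak-star topology is the topology of pointwise convergence on A;
   [set_type] carries the topology induced from the ambient space. *)
Definition characters : set {ptws A -> R[i]^o} := [set phi | is_character phi].

Definition char_space : topologicalType := set_type characters.

Definition gelfand (a : A) (phi : char_space) : R[i] :=
  (set_val phi : A -> R[i]) a.

Definition supp (a : A) : set char_space :=
  closure [set phi | gelfand a phi <> 0].

Definition I_ideal (phi : char_space) : set A := [set a | gelfand a phi = 0].

Definition J_ideal (phi : char_space) : set A := [set a | ~ supp a phi].

Definition ditkin_at (phi : char_space) : Prop :=
  forall a, I_ideal phi a -> closure [set a ** b | b in J_ideal phi] a.

Definition ditkin_algebra : Prop := forall phi : char_space, ditkin_at phi.

End ditkin.

Section mul_continuous.
Context {K : numFieldType} {A : comBanachAlgType K}.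

Lemma bmulBl (a b c : A) : (a - b) ** c = a ** c - b ** c.
Proof. by rewrite bmulDl -scaleN1r -bscalerAl scaleN1r. Qed.

Lemma bmulBr (a b c : A) : c ** (a - b) = c ** a - c ** b.
Proof. by rewrite !(bmulC c) bmulBl. Qed.

Lemma bmul_cvg (T : topologicalType) (F : set_system T) (f g : T -> A) a b :
  Filter F -> f @ F --> a -> g @ F --> b -> (fun x => f x ** g x) @ F --> a ** b.
Proof.
move=> FF fa gb; apply/cvgrPdist_lt => e e0.
pose M := (`|a| + 1) + `|b|.
have M0 : 0 < M by rewrite /M -addrA ltr_wpDl// ltr_wpDr.
have d0 : 0 < e / (M *+ 2) by rewrite divr_gt0// mulrn_wgt0.
near=> x.
have fx : `|a - f x| < e / (M *+ 2) by near: x; exact: cvgr_dist_lt.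
have gx : `|b - g x| < e / (M *+ 2) by near: x; exact: cvgr_dist_lt.
have fx1 : `|a - f x| < 1 by near: x; exact: cvgr_dist_lt.
have -> : a ** b - f x ** g x = (a - f x) ** b + f x ** (b - g x).
  by rewrite bmulBl bmulBr addrA subrK.
have fxM : `|f x| <= M.
  rewrite -(subrK a (f x)) (le_trans (ler_normD _ _))// distrC.
  rewrite (@le_trans _ _ (`|a| + 1)) ?lerDl//.
  by rewrite addrC lerD2l ltW.
have bM : `|b| <= M by rewrite lerDr addr_ge0.
rewrite (le_lt_trans (ler_normD _ _))// (@le_lt_trans _ _
  (`|a - f x| * M + M * `|b - g x|))//.
  rewrite lerD// (le_trans (bnormM_le _ _))//.
    by rewrite ler_wpM2l.
  by rewrite ler_wpM2r.
have -> : e = e / (M *+ 2) * M + M * (e / (M *+ 2)).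
  rewrite [M * _]mulrC -mulr2n -mulrnAr -mulrA mulVf ?mulr1//.
  by rewrite gt_eqF// mulrn_wgt0.
by rewrite ltrD// ?ltr_pM2r// ltr_pM2l.
Unshelve. all: by end_near. Qed.

End mul_continuous.

(* The algebra C(X, E). The proof that X is compact is an index of the type
   because finiteness of the sup norm depends on it. *)
Definition contfun (X : topologicalType) (cX : compact [set: X])
  (E : topologicalType) : Type := continuousType X E.

HB.instance Definition _ (X : topologicalType) (cX : compact [set: X])
  (E : topologicalType) := Choice.on (contfun cX E).

Section contfun_algebra.
Context {R : realType} {X : topologicalType} (cX : compact [set: X]).
Context {E : comBanachAlgType R[i]}.
Local Notation CXE := (contfun cX E).
Implicit Types f g h : CXE.

Lemma contfun_continuous f : continuous (f : X -> E).
Proof. exact: cts_fun. Qed.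

Definition contfun_mk (u : X -> E) (cu : continuous u) : CXE :=
  (mkcts cu : continuousType X E).

Lemma contfunP f g : (forall x, f x = g x) -> f = g.
Proof. by move=> fg; apply/continuousEP. Qed.

Let cst_cts (e : E) : continuous (fun _ : X => e).
Proof. by move=> x; exact: cvg_cst. Qed.
Let add_cts f g : continuous (fun x => f x + g x).
Proof. by move=> x; apply: cvgD; exact: contfun_continuous. Qed.
Let opp_cts f : continuous (fun x => - f x).
Proof. by move=> x; apply: cvgN; exact: contfun_continuous. Qed.
Let mul_cts f g : continuous (fun x => f x ** g x).
Proof. by move=> x; apply: bmul_cvg; exact: contfun_continuous. Qed.
Let scale_cts (k : R[i]) f : continuous (fun x => k *: f x).
Proof. by move=> x; apply: cvgZr; exact: contfun_continuous. Qed.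

Definition contfun_zero : CXE := contfun_mk (@cst_cts 0).
Definition contfun_one : CXE := contfun_mk (@cst_cts bone).
Definition contfun_add f g : CXE := contfun_mk (@add_cts f g).
Definition contfun_opp f : CXE := contfun_mk (@opp_cts f).
Definition contfun_mul f g : CXE := contfun_mk (@mul_cts f g).
Definition contfun_scale (k : R[i]) f : CXE := contfun_mk (@scale_cts k f).

Let addA : associative contfun_add.
Proof. by move=> f g h; apply: contfunP => x; exact: addrA. Qed.
Let addC : commutative contfun_add.
Proof. by move=> f g; apply: contfunP => x; exact: addrC. Qed.
Let add0 : left_id contfun_zero contfun_add.
Proof. by move=> f; apply: contfunP => x; exact: add0r. Qed.
Let addN : left_inverse contfun_zero contfun_opp contfun_add.
Proof. by move=> f; apply: contfunP => x; exact: addNr. Qed.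

HB.instance Definition _ := GRing.isZmodule.Build CXE addA addC add0 addN.

Let scaleA a b f : contfun_scale a (contfun_scale b f) = contfun_scale (a * b) f.
Proof. by apply: contfunP => x; exact: scalerA. Qed.
Let scale1 : left_id 1 contfun_scale.
Proof. by move=> f; apply: contfunP => x; exact: scale1r. Qed.
Let scaleDr : right_distributive contfun_scale +%R.
Proof. by move=> k f g; apply: contfunP => x; exact: scalerDr. Qed.
Let scaleDl f : {morph contfun_scale^~ f : a b / a + b}.
Proof. by move=> a b; apply: contfunP => x; exact: scalerDl. Qed.

HB.instance Definition _ :=
  GRing.Zmodule_isLmodule.Build R[i] CXE scaleA scale1 scaleDr scaleDl.

Lemma contfun0E x : (0 : CXE) x = 0. Proof. by []. Qed.
Lemma contfunDE f g x : (f + g) x = f x + g x. Proof. by []. Qed.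
Lemma contfunNE f x : (- f) x = - f x. Proof. by []. Qed.
Lemma contfunBE f g x : (f - g) x = f x - g x. Proof. by []. Qed.
Lemma contfunZE k f x : (k *: f) x = k *: f x. Proof. by []. Qed.

(* Norms take their values in the nonnegative elements of R[i]; the supremum
   is taken in R. *)
Definition sup_norm f : R[i] :=
  (sup [set complex.Re `|f x| | x in [set: X]])%:C.

Let Re_norm (e : E) : (complex.Re `|e|)%:C = `|e|.
Proof. by rewrite RRe_real// ger0_real. Qed.

Let Re_norm_continuous f : continuous (fun x => complex.Re `|f x| : R).
Proof.
move=> x; apply/cvgrPdist_lt => e e0.
have e0' : 0 < e%:C by rewrite (ltcR 0 e).
near=> y; rewrite -ltcR.
have : `|f x - f y| < e%:C.
  by near: y; apply: cvgr_dist_lt => //; exact: contfun_continuous.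
apply: le_lt_trans; apply: le_trans (ler_dist_dist _ _).
apply: le_trans (normc_ge_Re _).
by case: `|f x| => ? ?; case: `|f y|.
Unshelve. all: by end_near. Qed.

Let norm_has_ubound f : has_ubound [set complex.Re `|f x| | x in [set: X]].
Proof.
have cf : compact [set complex.Re `|f x| | x in [set: X]].
  by apply: continuous_compact => //; exact/continuous_subspaceT/Re_norm_continuous.
have [M [_ MP]] := compact_bounded cf.
exists (M + 1) => y fy; apply: (le_trans (ler_norm y)).
by apply: MP => //; rewrite ltrDl.
Qed.

Lemma le_sup_norm f x : `|f x| <= sup_norm f.
Proof.
rewrite -Re_norm lecR; apply: ub_le_sup; first exact: norm_has_ubound.
by exists x.
Qed.

Lemma sup_norm_le f (M : R[i]) :
  0 <= M -> (forall x, `|f x| <= M) -> sup_norm f <= M.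
Proof.
move=> M0 fM; have <- : (complex.Re M)%:C = M by rewrite RRe_real// ger0_real.
rewrite lecR; have [->|/set0P ne] :=
    eqVneq [set complex.Re `|f x| | x in [set: X]] set0.
  by rewrite sup0; move: M0; rewrite lecE => /andP[].
by apply: ge_sup => // _ [x _ <-]; move: (fM x); rewrite lecE => /andP[].
Qed.

Lemma sup_norm_ge0 f : 0 <= sup_norm f.
Proof.
rewrite (ler0c (sup _)); have [->|/set0P[y fy]] :=
    eqVneq [set complex.Re `|f x| | x in [set: X]] set0; first by rewrite sup0.
apply: (@le_trans _ _ y); last exact: ub_le_sup.
by case: fy => x _ <-; rewrite -ler0c Re_norm.
Qed.

Let sup_normD f g : sup_norm (f + g) <= sup_norm f + sup_norm g.
Proof.
apply: sup_norm_le => [|x]; first by rewrite addr_ge0// sup_norm_ge0.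
by rewrite (le_trans (ler_normD _ _))// lerD// le_sup_norm.
Qed.

Let sup_normZ_le (k : R[i]) f : sup_norm (k *: f) <= `|k| * sup_norm f.
Proof.
apply: sup_norm_le => [|x]; first by rewrite mulr_ge0// sup_norm_ge0.
by rewrite contfunZE normrZ ler_wpM2l// le_sup_norm.
Qed.

Let sup_norm_eq0 f : sup_norm f = 0 -> f = 0.
Proof.
move=> f0; apply: contfunP => x; apply/eqP.
by rewrite -normr_le0 -f0 le_sup_norm.
Qed.

Let sup_normZ (k : R[i]) f : sup_norm (k *: f) = `|k| * sup_norm f.
Proof.
apply/eqP; rewrite eq_le sup_normZ_le/=.
have [->|k0] := eqVneq k 0; first by rewrite normr0 mul0r sup_norm_ge0.
rewrite -ler_pdivlMl ?normr_gt0// -normfV.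
by rewrite -[in leLHS](scalerK k0 f) sup_normZ_le.
Qed.

HB.instance Definition _ := @Lmodule_isNormed.Build R[i] CXE
  sup_norm sup_normD sup_normZ sup_norm_eq0.

Lemma contfun_normE f : `|f| = sup_norm f. Proof. by []. Qed.

Let contfun_complete (F : set_system CXE) :
  ProperFilter F -> cauchy F -> cvg F.
Proof.
move=> FF /cauchy_ballP Fc.
have Fe (e : R[i]) : 0 < e ->
    exists2 A, F A & forall f g, A f -> A g -> forall x, `|f x - g x| < e.
  move=> e0; have [[A B] /= [FA FB] AB] := Fc _ e0.
  exists (A `&` B); first exact: filterI.
  move=> f g [Af _] [_ Bg] x.
  have /= := AB (f, g) (conj Af Bg); rewrite -ball_normE /ball_/=.
  by apply: le_lt_trans; rewrite -contfunBE le_sup_norm.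
have Fx x : cvg ((fun f : CXE => f x) @ F).
  apply: cauchy_cvg; apply/cauchy_ballP => e e0.
  have [A FA AP] := Fe _ e0.
  pose B : set E := (fun f : CXE => f x) @` A.
  have FB : ((fun f : CXE => f x) @ F) B.
    by apply: (@filterS _ F _ A _ _ FA) => f Af; exists f.
  exists (B, B); first by split.
  move=> [_ _] /= [[f Af <-] [g Ag <-]].
  by rewrite -ball_normE; exact: AP.
pose u x : E := lim ((fun f : CXE => f x) @ F).
have Fu (e : R[i]) : 0 < e ->
    exists2 A, F A & forall f, A f -> forall x, `|u x - f x| < e.
  move=> e0; have [|A FA AP] := Fe (e / 2); first by rewrite divr_gt0.
  exists A => // f Af x.
  have /cvgr_dist_lt/(_ (e / 2)) uF : (fun f : CXE => f x) @ F --> u x by exact: Fx.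
  have [|h [Ah hu]] := filter_ex (filterI FA (uF _)); first by rewrite divr_gt0.
  rewrite (splitr e) -(subrK (h x) (u x)) -addrA.
  by rewrite (le_lt_trans (ler_normD _ _))// ltrD// AP.
have cu : continuous u.
  move=> x; apply/cvgrPdist_lt => e e0.
  have [|A FA AP] := Fu (e / 2 / 2); first by rewrite !divr_gt0.
  have [f Af] := filter_ex FA.
  near=> y.
  have fxy : `|f x - f y| < e / 2.
    near: y; apply: cvgr_dist_lt; last by rewrite divr_gt0.
    exact: contfun_continuous.
  have -> : u x - u y = (u x - f x) + ((f x - f y) + (f y - u y)).
    by rewrite !subrKA.
  rewrite addrCA (le_lt_trans (ler_normD _ _))// (splitr e) ltrD//.
  rewrite (le_lt_trans (ler_normD _ _))// (splitr (e / 2)) ltrD//.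
    exact: AP.
  by rewrite distrC AP.
apply/cvg_ex; exists (contfun_mk cu : CXE).
apply/cvgrPdist_le => e e0; have [A FA AP] := Fu _ e0.
apply: filterS FA => f Af.
by apply: sup_norm_le => [|x]; [exact: ltW|exact/ltW/AP].
Unshelve. all: by end_near. Qed.

HB.instance Definition _ := Uniform_isComplete.Build CXE contfun_complete.

Let mulA : associative contfun_mul.
Proof. by move=> f g h; apply: contfunP => x; exact: bmulA. Qed.
Let mulC : commutative contfun_mul.
Proof. by move=> f g; apply: contfunP => x; exact: bmulC. Qed.
Let mul1 : left_id contfun_one contfun_mul.
Proof. by move=> f; apply: contfunP => x; exact: bmul1r. Qed.
Let mulD : left_distributive contfun_mul +%R.
Proof. by move=> f g h; apply: contfunP => x; exact: bmulDl. Qed.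

Let scaleAl (k : R[i]) f g : k *: contfun_mul f g = contfun_mul (k *: f) g.
Proof. by apply: contfunP => x; exact: bscalerAl. Qed.

Let normM_le f g : `|contfun_mul f g| <= `|f| * `|g|.
Proof.
apply: sup_norm_le => [|x]; first by rewrite mulr_ge0.
by rewrite (le_trans (bnormM_le _ _))// ler_pM// le_sup_norm.
Qed.

HB.instance Definition _ := CompleteNormedModule_isComBanachAlgebra.Build
  R[i] CXE mulA mulC mul1 mulD scaleAl normM_le.

Lemma contfun1E x : (bone : CXE) x = bone. Proof. by []. Qed.
Lemma contfunME f g x : (f ** g) x = f x ** g x. Proof. by []. Qed.

End contfun_algebra.

(* Main.v *)
(* Every character psi of C(X, E) is f |-> phi (f x0), where phi is the
   restriction of psi to constants and x0 is a common zero of all real functions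
   u with psi (u 1) = 0: the zero sets of such u generate a proper filter on X,
   which clusters by compactness. Composing with evaluation at x0 is continuous
   from M(E) to M(C(X, E)), so Ditkin's condition passes from C(X, E) to E through
   constants.
   Conversely, if f x0 ** b is close to f x0 with b vanishing near phi, then
   p = 1 - h (1 - b) works for f, where h is a bump function equal to 1 near x0
   and supported where f is close to f x0; h is a function of |f x - f x0|. *)
Require Import Defs.
From mathcomp Require Import all_boot all_order all_algebra.
From mathcomp Require Import all_classical all_reals all_analysis.
From mathcomp.real_closed Require Import complex.
From mathcomp Require Import ring.
Local Open Scope classical_set_scope.

Set Implicit Arguments.
Unset Strict Implicit.
Unset Printing Implicit Defensive.

Import Order.TTheory GRing.Theory Num.Theory.
Import numFieldNormedType.Exports.

Local Open Scope ring_scope.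
Local Open Scope complex_scope.

(** * Characters, Gelfand transforms and Ditkin's condition in epsilon form *)

Section characters.
Context {R : realType} {A : comBanachAlgType R[i]}.
Implicit Types (a b : A) (phi : char_space A).

Lemma char_spaceP phi : is_character (set_val phi : A -> R[i]).
Proof. exact: (set_valP phi). Qed.

Definition character_mk (phi : A -> R[i]) (cphi : is_character phi) :
  char_space A := SigSub (mem_set (cphi : @characters R A phi)).

Lemma gelfandD a b phi : gelfand (a + b) phi = gelfand a phi + gelfand b phi.
Proof.
by have [lphi _ _] := char_spaceP phi; have := lphi 1 a b; rewrite scale1r mul1r.
Qed.

Lemma gelfand0 phi : gelfand (0 : A) phi = 0.
Proof. by apply: (addrI (gelfand 0 phi)); rewrite -gelfandD !addr0. Qed.

Lemma gelfandZ (k : R[i]) a phi : gelfand (k *: a) phi = k * gelfand a phi.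
Proof.
have [lphi _ _] := char_spaceP phi.
have : gelfand (k *: a + 0) phi = k * gelfand a phi + gelfand 0 phi.
  exact: lphi.
by rewrite gelfand0 !addr0.
Qed.

Lemma gelfandN a phi : gelfand (- a) phi = - gelfand a phi.
Proof. by rewrite -scaleN1r gelfandZ mulN1r. Qed.

Lemma gelfandB a b phi : gelfand (a - b) phi = gelfand a phi - gelfand b phi.
Proof. by rewrite gelfandD gelfandN. Qed.

Lemma gelfandM a b phi : gelfand (a ** b) phi = gelfand a phi * gelfand b phi.
Proof. by have [_ mphi _] := char_spaceP phi; exact: mphi. Qed.

Lemma gelfand1 phi : gelfand (bone : A) phi = 1.
Proof.
have [_ _ [a /eqP a0]] := char_spaceP phi.
by apply: (mulIf a0); rewrite mul1r -[LHS]gelfandM bmul1r.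
Qed.

Lemma gelfand_continuous a : continuous (gelfand a : char_space A -> R[i]^o).
Proof.
move=> phi; apply: (@continuous_comp _ _ _ set_val
    (fun p : {ptws A -> R[i]^o} => p a)).
  exact: initial_continuous.
exact: (@proj_continuous A (fun=> R[i]^o) a).
Qed.

(** The topology of [char_space] is induced from pointwise convergence, so continuity can be tested
    on one [a] at a time. *)
Lemma continuous_char_space (Z : topologicalType) (T : Z -> char_space A) :
  (forall a, continuous (fun z => gelfand a (T z) : R[i]^o)) -> continuous T.
Proof.
move=> cT; apply: continuous_comp_initial => z.
by apply/pointwise_cvgP => a; exact: cT.
Qed.

(** Being outside a closure means having a neighbourhood that misses the set. In this form,
    membership in [J_ideal] pulls back along continuous maps of character spaces. *)
Lemma not_suppP a phi :
  ~ supp a phi <-> \forall psi \near phi, gelfand a psi = 0.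
Proof.
split=> [/existsNP[B /not_implyP[phiB /set0P/negP/negPn/eqP aB]]|a0 /(_ _ a0)].
  apply: filterS phiB => psi Bpsi; apply: contrapT => apsi.
  by have : set0 psi by rewrite -aB.
by case=> psi [/= npsi psi0].
Qed.

Lemma ditkin_atP phi : ditkin_at phi <->
  forall a, gelfand a phi = 0 -> forall e : R[i], 0 < e ->
  exists2 b, J_ideal phi b & `|a - a ** b| < e.
Proof.
split=> [D a /D aJ e e0|D a /D aJ B /nbhs_normP[e /= e0 eB]].
  have [_ [[b Jb <-]]] := aJ _ (nbhsx_ballx a e e0).
  by rewrite -ball_normE /= => ab; exists b.
by have [b Jb ab] := aJ _ e0; exists (a ** b); split; [exists b|exact: eB].
Qed.

End characters.

(** * Real numbers and norms inside [R[i]] *)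

Section complex_valued.
Context {R : realType}.

Lemma real_complex_continuous : continuous (fun r : R => r%:C : R[i]^o).
Proof.
move=> r; apply/cvgrPdist_lt => e e0.
(* In the order of [R[i]], a positive element has zero imaginary part. *)
have eE : (complex.Re e)%:C = e by rewrite RRe_real// gtr0_real.
near=> s; rewrite -rmorphB normc_def/= expr0n addr0 sqrtr_sqr -eE ltcR.
by near: s; apply: (@cvgr_dist_lt _ _ _ _ _ id) => //; rewrite -ltcR eE.
Unshelve. all: by end_near. Qed.

Lemma norm_real_complex (r : R) : `|r%:C| = `|r|%:C.
Proof. by rewrite normc_def/= expr0n addr0 sqrtr_sqr. Qed.

(** Norms lie in [R[i]]; passing to the real part loses nothing and gives access to square roots,
    minima and maxima in [R]. *)
Lemma Re_normK (V : normedModType R[i]) (v : V) :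
  (complex.Re `|v|)%:C = `|v|.
Proof. by rewrite RRe_real// ger0_real. Qed.

Lemma Re_norm_ge0 (V : normedModType R[i]) (v : V) : 0 <= complex.Re `|v|.
Proof. by rewrite -ler0c Re_normK. Qed.

Lemma Re_norm_eq0 (V : normedModType R[i]) (v : V) :
  complex.Re `|v| = 0 -> v = 0.
Proof. by move=> v0; apply/eqP; rewrite -normr_eq0 -Re_normK v0. Qed.

Lemma continuous_Re_norm (V : normedModType R[i]) :
  continuous (fun v : V => complex.Re `|v| : R).
Proof.
move=> v; apply/cvgrPdist_lt => e e0; rewrite -ltcR in e0.
near=> w; rewrite -ltcR -norm_real_complex rmorphB/= !Re_normK.
apply: le_lt_trans (ler_dist_dist _ _) _.
by near: w; exact: (@cvgr_dist_lt _ _ _ _ _ id).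
Unshelve. all: by end_near. Qed.

End complex_valued.

(** * Real multipliers, constants and evaluations in C(X, E) *)

Section contfun.
Context {R : realType} {X : topologicalType} (cX : compact [set: X]).
Context {E : comBanachAlgType R[i]}.
Local Notation CXE := (contfun cX E).
Implicit Types (f g : CXE) (u v : X -> R).

Lemma continuous_real_scale u f :
  continuous u -> continuous (fun x => (u x)%:C *: f x).
Proof.
move=> cu x; apply: cvgZ; last exact: contfun_continuous.
by apply: (continuous_comp (cu x)); exact: real_complex_continuous.
Qed.

Definition real_scale u (cu : continuous u) f : CXE :=
  contfun_mk cX (continuous_real_scale (f := f) cu).

Lemma continuous_Re_norm_contfun f : continuous (fun x => complex.Re `|f x|).
Proof.
move=> x; apply: (@continuous_comp _ _ _ f (fun e : E => complex.Re `|e|)).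
  exact: contfun_continuous.
exact: continuous_Re_norm.
Qed.

Definition const_fun (e : E) : CXE :=
  contfun_mk cX (fun x => cvg_cst e).

Lemma real_scaleE u (cu : continuous u) f x :
  real_scale cu f x = (u x)%:C *: f x.
Proof. by []. Qed.

Lemma real_scaleMl u (cu : continuous u) f g :
  real_scale cu f ** g = real_scale cu (f ** g).
Proof. by apply: contfunP => x; exact/esym/bscalerAl. Qed.

Lemma is_character_const (psi : char_space CXE) :
  is_character (fun e => gelfand (const_fun e) psi).
Proof.
split=> [k a b|a b|].
- by rewrite -gelfandZ -gelfandD; congr gelfand; exact: contfunP.
- by rewrite -gelfandM; congr gelfand; exact: contfunP.
- exists bone; have -> : const_fun bone = bone by exact: contfunP.
  by rewrite gelfand1; apply/eqP; exact: oner_neq0.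
Qed.

Definition char_const psi : char_space E := character_mk (is_character_const psi).

Lemma gelfand_char_const e psi :
  gelfand e (char_const psi) = gelfand (const_fun e) psi.
Proof. by []. Qed.

Lemma char_const_continuous : continuous char_const.
Proof. by apply: continuous_char_space => a; exact: gelfand_continuous. Qed.

Lemma is_character_eval (x : X) (phi : char_space E) :
  is_character (fun f : CXE => gelfand (f x) phi).
Proof.
split=> [k f g|f g|].
- by rewrite contfunDE contfunZE gelfandD gelfandZ.
- by rewrite contfunME gelfandM.
- by exists bone; rewrite contfun1E gelfand1; apply/eqP; exact: oner_neq0.
Qed.

Definition char_eval x phi : char_space CXE :=
  character_mk (is_character_eval x phi).

Lemma gelfand_char_eval f x phi : gelfand f (char_eval x phi) = gelfand (f x) phi.
Proof. by []. Qed.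

Lemma char_eval_continuous x : continuous (char_eval x).
Proof. by apply: continuous_char_space => f; exact: gelfand_continuous. Qed.

End contfun.

(** * Every character of C(X, E) factors through evaluation at a point *)

Section contfun_characters.
Context {R : realType} {X : topologicalType} (cX : compact [set: X]).
Context {E : comBanachAlgType R[i]}.
Local Notation CXE := (contfun cX E).
Implicit Types (f g : CXE) (u v : X -> R) (psi : char_space CXE).

Definition real_fun u (cu : continuous u) : CXE := real_scale cu bone.

Lemma real_funM u v (cu : continuous u) (cv : continuous v)
    (cuv : continuous (fun x => u x * v x)) :
  real_fun cu ** real_fun cv = real_fun cuv.
Proof.
apply: contfunP => x; rewrite contfunME !real_scaleE -bscalerAl bmul1r.
by rewrite scalerA -rmorphM.
Qed.

Lemma real_funD u v (cu : continuous u) (cv : continuous v)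
    (cuv : continuous (fun x => u x + v x)) :
  real_fun cu + real_fun cv = real_fun cuv.
Proof.
by apply: contfunP => x; rewrite contfunDE !real_scaleE -scalerDl -rmorphD.
Qed.

Lemma real_fun_cst (c : R) (cc : continuous (fun _ : X => c)) :
  real_fun cc = c%:C *: bone.
Proof. exact: contfunP. Qed.

Lemma gelfand_real_scale u (cu : continuous u) f psi :
  gelfand (real_scale cu f) psi = gelfand (real_fun cu) psi * gelfand f psi.
Proof. by rewrite -gelfandM real_scaleMl bmul1r. Qed.

Lemma zero_set_gelfand_ker psi :
  exists x0, forall u (cu : continuous u),
    gelfand (real_fun cu) psi = 0 -> u x0 = 0.
Proof.
pose F : set_system X := [set S | exists u (cu : continuous u),
  gelfand (real_fun cu) psi = 0 /\ [set x | u x = 0] `<=` S].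
have cc (c : R) : continuous (fun _ : X => c) by move=> x; exact: cvg_cst.
have cM u v : continuous u -> continuous v -> continuous (fun x => u x * v x).
  by move=> cu cv x; apply: cvgM; [exact: cu|exact: cv].
have cD u v : continuous u -> continuous v -> continuous (fun x => u x + v x).
  by move=> cu cv x; apply: cvgD; [exact: cu|exact: cv].
have FF : ProperFilter F.
  split.
    move=> [u [cu [u0 uS]]].
    (* If the empty set were in [F], some [u] without zeros would have psi (u 1) = 0, although u 1
       is invertible. *)
    have un0 x : u x != 0 by apply/eqP => /uS.
    have cV : continuous (fun x => (u x)^-1).
      by move=> x; apply: cvgV => //; exact: cu.
    have : real_fun (cM _ _ cV cu) = bone.
      apply: contfunP => x; rewrite real_scaleE mulVf//.
      by rewrite rmorph1 scale1r.
    rewrite -(real_funM cV cu) => /(congr1 (fun f => gelfand f psi)) /eqP.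
    by rewrite gelfandM u0 mulr0 gelfand1 eq_sym oner_eq0.
  split.
  - exists (fun=> 0), (cc 0); split => //.
    by rewrite real_fun_cst scale0r gelfand0.
  - move=> S T [u [cu [u0 uS]]] [v [cv [v0 vT]]].
    (* For real functions, the zero set of u^2 + v^2 is the intersection of the two zero sets. *)
    exists (fun x => u x * u x + v x * v x), (cD _ _ (cM _ _ cu cu) (cM _ _ cv cv)).
    split.
      rewrite -(real_funD (cM _ _ cu cu) (cM _ _ cv cv)).
      rewrite -(real_funM cu cu) -(real_funM cv cv).
      by rewrite gelfandD !gelfandM u0 v0 !mulr0 addr0.
    move=> x /eqP; rewrite -!expr2 paddr_eq0 ?sqr_ge0// !sqrf_eq0.
    by move=> /andP[/eqP ux /eqP vx]; split; [exact: uS|exact: vT].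
  - move=> S T ST [u [cu [u0 uS]]]; exists u, cu; split => //.
    exact: subset_trans ST.
have FT : F setT by exact: filterT.
have [x0 [_ Fx0]] := cX FF FT.
(* Otherwise [u] is nonzero on a neighbourhood of the cluster point [x0], which must meet the zero
   set of [u], a member of [F]. *)
exists x0 => u cu u0; apply: contrapT => /eqP ux0.
have Fu : F [set x | u x = 0] by exists u, cu; split.
have Bu : nbhs x0 [set x | u x != 0] by exact: (cvgr_neq0 _ (cu x0)).
by have [x [/= ->]] := Fx0 _ _ Fu Bu; rewrite eqxx.
Qed.

(** The value psi (u 1) = a + ib is not known to be real. A real function [v] killed by psi, with v
    x0 = a^2 + b^2, forces a = b = 0. *)
Lemma gelfand_real_fun_eq0 psi x0 :
  (forall u (cu : continuous u), gelfand (real_fun cu) psi = 0 -> u x0 = 0) ->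
  forall u (cu : continuous u), u x0 = 0 -> gelfand (real_fun cu) psi = 0.
Proof.
move=> psi0 u cu ux0; case lE : (gelfand (real_fun cu) psi) => [a b].
(* v = |u - (a + ib)|^2, whose image under psi is (ib)^2 + b^2 = 0. *)
pose v x := (u x - a) * (u x - a) + b * b.
have cv1 : continuous (fun x => u x - a).
  by move=> x; apply: cvgB; [exact: cu|exact: cvg_cst].
have cv2 : continuous (fun x => (u x - a) * (u x - a)).
  by move=> x; apply: cvgM; exact: cv1.
have cc (c : R) : continuous (fun _ : X => c) by move=> x; exact: cvg_cst.
have cv : continuous v by move=> x; apply: cvgD; [exact: cv2|exact: cvg_cst].
have /psi0 : gelfand (real_fun cv) psi = 0.
  rewrite -(real_funD cv2 (cc (b * b))) -(real_funM cv1 cv1).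
  rewrite -(real_funD cu (cc (- a))) !real_fun_cst.
  rewrite gelfandD gelfandM gelfandD lE !gelfandZ gelfand1 !mulr1.
  by apply/eqP; rewrite eq_complex/=; apply/andP; split; apply/eqP; ring.
rewrite /v ux0 sub0r mulrNN -!expr2 => /eqP.
by rewrite paddr_eq0 ?sqr_ge0// !sqrf_eq0 => /andP[/eqP-> /eqP->].
Qed.

(** The difference of [f] and the constant [f x0] is a real function vanishing at [x0] times an
    element of C(X, E), hence is killed by psi. The first conjunct is kept to show later that psi
    does not kill a real function that is nonzero at [x0]. *)
Lemma character_factorization psi : exists x0,
  (forall u (cu : continuous u), gelfand (real_fun cu) psi = 0 -> u x0 = 0) /\
  forall f, gelfand f psi = gelfand (f x0) (char_const psi).
Proof.
have [x0 psi0] := zero_set_gelfand_ker psi; exists x0; split => // f.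
rewrite gelfand_char_const; apply/eqP; rewrite -subr_eq0 -gelfandB; apply/eqP.
set g : CXE := f - _.
have gx0 : g x0 = 0 by rewrite /g contfunBE subrr.
(* g = s k with s = |g|^(1/2) and k = g / |g|^(1/2), continuous where g vanishes
   because |k| = s there (and 0^-1 = 0 makes k vanish). *)
pose s x : R := Num.sqrt (complex.Re `|g x|).
have cs : continuous s.
  move=> x; apply: (@continuous_comp _ _ _ (fun x => complex.Re `|g x|)).
    exact: continuous_Re_norm_contfun.
  exact: sqrt_continuous.
have s0 x : s x = 0 -> g x = 0.
  move=> /eqP; rewrite sqrtr_eq0 => gx; apply: Re_norm_eq0.
  by apply/le_anti; rewrite gx Re_norm_ge0.
pose k x := (s x)^-1%:C *: g x.
have ck : continuous k.
  move=> x; have [sx|sx] := eqVneq (s x) 0; last first.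
    apply: cvgZ; last exact: contfun_continuous.
    apply: (@continuous_comp _ _ _ (fun y => (s y)^-1)).
      by apply: cvgV => //; exact: cs.
    exact: real_complex_continuous.
  rewrite /continuous_at/= {2}/k (s0 _ sx) scaler0; apply: norm_cvg0.
  have -> : (fun y => `|k y|) = (fun y => (s y)%:C).
    apply/funext => y; rewrite /k normrZ norm_real_complex.
    rewrite -Re_normK -(sqr_sqrtr (Re_norm_ge0 (g y))) -/(s y) -rmorphM.
    rewrite ger0_norm ?invr_ge0 ?sqrtr_ge0//; congr (_%:C).
    by have [->|sy] := eqVneq (s y) 0; [rewrite invr0 mul0r|rewrite expr2 mulKf].
  have : (fun y => (s y)%:C : R[i]^o) @ x --> ((s x)%:C : R[i]^o).
    by apply: continuous_comp; [exact: cs|exact: real_complex_continuous].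
  by rewrite sx.
have -> : g = real_scale cs (contfun_mk cX ck).
  apply: contfunP => x; rewrite real_scaleE -[contfun_mk _ _ _]/(k x) /k scalerA -rmorphM.
  have [/[dup] /s0 -> ->|sx] := eqVneq (s x) 0; first by rewrite scaler0.
  by rewrite divff// rmorph1 scale1r.
rewrite gelfand_real_scale (gelfand_real_fun_eq0 psi0) ?mul0r//.
by rewrite /s gx0 normr0 sqrtr0.
Qed.

End contfun_characters.

(** * Transfer of Ditkin's condition between C(X, E) and E *)

Section ditkin_contfun.
Context {R : realType} {X : topologicalType} (cX : compact [set: X]).
Context {E : comBanachAlgType R[i]}.
Local Notation CXE := (contfun cX E).

Lemma ditkin_of_contfun :
  [set: X] !=set0 -> ditkin_algebra CXE -> ditkin_algebra E.
Proof.
move=> [x0 _] D phi; apply/ditkin_atP => a a0 e e0.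
have [|f Jf ef] :=
  (ditkin_atP _).1 (D (char_eval cX x0 phi)) (const_fun cX a) _ e e0.
  by rewrite gelfand_char_eval.
exists (f x0).
  (* [f] vanishes near the image of [phi] under [char_eval]; by continuity [f x0] vanishes near
     [phi]. *)
  by apply/not_suppP; have /not_suppP/char_eval_continuous := Jf.
apply: le_lt_trans ef.
exact: (le_sup_norm (const_fun cX a - const_fun cX a ** f) x0).
Qed.

Lemma contfun_of_ditkin : ditkin_algebra E -> ditkin_algebra CXE.
Proof.
move=> D psi; apply/ditkin_atP => f f0 e e0.
have [x0 [psi0 psiE]] := character_factorization psi.
(* Two errors of e / 4 give e / 2; the remaining room is needed because a supremum inherits only the
   non-strict bound. *)
have e40 : 0 < e / 2 / 2 by rewrite !divr_gt0.
have [|b Jb eb] := (ditkin_atP _).1 (D (char_const psi)) (f x0) _ _ e40.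
  by rewrite -psiE.
pose c := bone - b.
(* Chosen so that a norm of [g x] below [rC] makes [g x ** c] at most e / 4; the + 1 keeps the
   denominator positive. *)
pose rC := e / 2 / 2 / (`|c| + 1).
have rC0 : 0 < rC by rewrite divr_gt0// ltr_wpDl.
pose r := complex.Re rC.
have rE : r%:C = rC by rewrite RRe_real// gtr0_real.
have r0 : 0 < r by rewrite -ltcR rE.
pose g : CXE := f - const_fun cX (f x0).
pose N x := complex.Re `|g x|.
have cN : continuous N := @continuous_Re_norm_contfun _ _ _ _ g.
have Nx0 : N x0 = 0 by rewrite /N /g contfunBE subrr normr0.
(* [h] is 1 where N <= r / 2, 0 where N >= r, and affine in [N] between. *)
pose h x := Num.max 0 (Num.min 1 (2 - N x / (r / 2))).
(* [q] is nonzero only where N < r / 2, hence where h = 1, and q x0 = r / 2. *)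
pose q x := Num.max 0 (r / 2 - N x).
have cc (k : R) : continuous (fun _ : X => k) by move=> x; exact: cvg_cst.
have ch : continuous h.
  move=> x; apply: (@continuous_max _ _ (fun=> 0)
    (fun y => Num.min 1 (2 - N y / (r / 2)))); first exact: cc.
  apply: (@continuous_min _ _ (fun=> 1) (fun y => 2 - N y / (r / 2))).
    exact: cc.
  apply: cvgB; first exact: cc.
  by apply: cvgM; [exact: cN|exact: cc].
have cq : continuous q.
  move=> x; apply: (@continuous_max _ _ (fun=> 0) (fun y => r / 2 - N y)).
    exact: cc.
  by apply: cvgB; [exact: cc|exact: cN].
have qh x : q x * h x = q x.
  rewrite /q /h; have [Nr|rN] := leP (r / 2) (N x).
    by rewrite max_l ?subr_le0// mul0r.
  have -> : Num.min 1 (2 - N x / (r / 2)) = 1.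
    apply/min_l; rewrite lerBrDr -lerBrDl.
    by rewrite ler_pdivrMr ?divr_gt0// (_ : 2 - 1 = 1) ?mul1r 1?ltW//; ring.
  by rewrite [Num.max 0 1]max_r ?mulr1 ?ler01.
have h_ge0 x : 0 <= h x by rewrite /h le_max lexx.
have h_le1 x : h x <= 1 by rewrite /h ge_max ler01 ge_min lexx.
have hN x : r <= N x -> h x = 0.
  move=> rN; apply/max_l; rewrite ge_min; apply/orP; right.
  rewrite subr_le0 ler_pdivlMr ?divr_gt0//.
  by rewrite mulrC divfK ?pnatr_eq0.
pose p : CXE := bone - real_scale ch (const_fun cX c).
have pE x : p x = bone - (h x)%:C *: c by [].
exists p.
  apply/not_suppP.
  (* psi' (q 1) is nonzero near psi, and q p = q b since q (1 - h) = 0. *)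
  have qp : real_scale cq p = real_scale cq (const_fun cX b).
    apply: contfunP => x; rewrite !real_scaleE pE scalerBr scalerA -rmorphM qh.
    by rewrite -scalerBr /c opprB addrC subrK.
  have q_neq0 : \forall psi' \near psi, gelfand (real_fun cX cq) psi' != 0.
    apply: (@cvgr_neq0 _ R[i]^o _ _ _ (gelfand (real_fun cX cq)) _
      (@gelfand_continuous _ _ _ psi)).
    (* If psi killed q 1, then q x0 would be 0 instead of r / 2. *)
    apply/eqP => /psi0; rewrite /q Nx0 subr0 => /eqP.
    by rewrite max_r ?gt_eqF ?ltW// divr_gt0.
  have b0 : \forall psi' \near psi, gelfand b (char_const psi') = 0.
    by have /not_suppP/char_const_continuous := Jb.
  near=> psi'.
  have q' : gelfand (real_fun cX cq) psi' != 0 by near: psi'.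
  apply: (mulfI q'); rewrite mulr0 -gelfand_real_scale qp gelfand_real_scale.
  rewrite -gelfand_char_const (_ : gelfand b _ = 0) ?mulr0//.
  by near: psi'.
apply: (@le_lt_trans _ _ (e / 2)); last by rewrite ltr_pdivrMr// ltr_pMr// ltr1n.
apply: sup_norm_le => [|x]; first by rewrite divr_ge0// ltW.
have -> : (f - f ** p) x = (h x)%:C *: (f x ** c).
  rewrite contfunBE contfunME pE bmulBr (bmulC _ bone) bmul1r opprB addrC subrK.
  by rewrite !(bmulC (f x)) bscalerAl.
(* Where N >= r the error is zero since [h] vanishes; elsewhere h <= 1 and [f x] is close to
   [f x0]. *)
have [/hN ->|Nr] := leP r (N x).
  by rewrite scale0r normr0 divr_ge0// ltW.
rewrite normrZ norm_real_complex ger0_norm//.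
apply: (@le_trans _ _ `|f x ** c|).
  by rewrite ler_piMl// lecR.
(* The first term is f x0 - f x0 b, small by the choice of [b]; the second is small by the choice of
   [rC]. *)
have -> : f x ** c = f x0 ** c + g x ** c.
  by rewrite -bmulDl /g contfunBE addrC subrK.
apply: le_trans (ler_normD _ _) _; rewrite (splitr (e / 2)) lerD//.
  by rewrite /c bmulBr (bmulC _ bone) bmul1r ltW.
apply: le_trans (bnormM_le _ _) _.
apply: (@le_trans _ _ (rC * (`|c| + 1))).
  by rewrite ler_pM// ?lerDl// -Re_normK -rE lecR ltW.
by rewrite /rC divfK// gt_eqF// ltr_wpDl.
Unshelve. all: by end_near. Qed.

End ditkin_contfun.

Theorem theorem1 (R : realType) (X : topologicalType)
    (X_nonempty : [set: X] !=set0) (cX : compact [set: X])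
    (hX : hausdorff_space X) (E : comBanachAlgType R[i]) :
  ditkin_algebra (contfun cX E) <-> ditkin_algebra E.
Proof. by split; [exact: ditkin_of_contfun|exact: contfun_of_ditkin]. Qed.
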